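(* Let $n\ge2$, let $T$ be a strict t-norm, let $p,q>0$, and let $\alpha_1,\dots,\alpha_n$ be picture fuzzy numbers. Then $$\mathrm{PFIBM}_T^{p,q}(\alpha_1,\dots,\alpha_n)=\mathrm{PFIBM}_T^{p,q}(\dot\alpha_1,\dots,\dot\alpha_n)$$ for every permutation $(\dot\alpha_1,\dots,\dot\alpha_n)$ of $(\alpha_1,\dots,\alpha_n)$.
   Context: A picture fuzzy number (PFN) is a triple $\alpha=\langle\mu,\eta,\nu\rangle$ with $\mu,\eta,\nu\in[0,1]$ and $\mu+\eta+\nu\le1$. A t-norm is a commutative, associative map $T:[0,1]^2\to[0,1]$, nondecreasing in each variable, with $T(1,x)=x$. It is strict if it is continuous and $T(x,y)<T(x,z)$ whenever $x>0$ and $y<z$. A strict t-norm has a continuous additive generator: a continuous strictly decreasing bijection $\tau:[0,1]\to[0,+\infty]$ with $\tau(1)=0$, $\tau(0)=+\infty$ and $T(x,y)=\tau^{-1}(\tau(x)+\tau(y))$. Its dual t-conorm is $S(x,y)=1-T(1-x,1-y)=\zeta^{-1}(\zeta(x)+\zeta(y))$, where $\zeta(x)=\tau(1-x)$. Arithmetic in $[0,+\infty]$ is the usual one ($a+\infty=\infty$, $\lambda\cdot\infty=\infty$ for $\lambda>0$). For a strict t-norm $T$, PFNs $\alpha_k=\langle\mu_k,\eta_k,\nu_k\rangle$ ($k=1,2$), $\alpha=\langle\mu,\eta,\nu\rangle$ and $\lambda>0$ define: $\alpha_1\oplus\alpha_2=\langle S(\mu_1,\mu_2),\,T(\eta_1+\nu_1,\eta_2+\nu_2)-T(\nu_1,\nu_2),\,T(\nu_1,\nu_2)\rangle$;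 $\alpha_1\otimes\alpha_2=\langle T(\mu_1,\mu_2),\,T(\eta_1+\mu_1,\eta_2+\mu_2)-T(\mu_1,\mu_2),\,S(\nu_1,\nu_2)\rangle$; $\lambda\cdot\alpha=\langle\zeta^{-1}(\lambda\zeta(\mu)),\,\tau^{-1}(\lambda\tau(\eta+\nu))-\tau^{-1}(\lambda\tau(\nu)),\,\tau^{-1}(\lambda\tau(\nu))\rangle$; $\alpha^\lambda=\langle\tau^{-1}(\lambda\tau(\mu)),\,\tau^{-1}(\lambda\tau(\eta+\mu))-\tau^{-1}(\lambda\tau(\mu)),\,\zeta^{-1}(\lambda\zeta(\nu))\rangle$. These operations send PFNs to PFNs, and $\oplus,\otimes$ are commutative and associative (known facts), so iterated $\bigoplus$ is well defined. For $p,q>0$ the picture fuzzy interactional Bonferroni mean induced by $T$ is $$\mathrm{PFIBM}_T^{p,q}(\alpha_1,\dots,\alpha_n)=\Big[\tfrac1{n(n-1)}\cdot\bigoplus_{i,j=1,\ i\ne j}^n(\alpha_i^p\otimes\alpha_j^q)\Big]^{\frac1{p+q}}.$$ *)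

(* Defs.v *)
From mathcomp Require Import all_boot all_order all_algebra all_fingroup.
From mathcomp Require Import all_classical all_reals all_analysis.
Import Order.TTheory GRing.Theory Num.Theory.
Import numFieldNormedType.Exports.

Set Implicit Arguments.
Unset Strict Implicit.
Unset Printing Implicit Defensive.

Local Open Scope classical_set_scope.
Local Open Scope ring_scope.

(* Functions on [0,1] are represented by functions on the whole of R; only
   their values on unitI are constrained by the definitions below. *)
Definition unitI (R : realType) : set R := `[0, 1].
Arguments unitI {R}.

Record tnorm (R : realType) (T : R -> R -> R) : Prop := Tnorm {
  tnorm_unitI : forall x y, unitI x -> unitI y -> unitI (T x y);
  tnormC : forall x y, unitI x -> unitI y -> T x y = T y x;
  tnormA : forall x y z, unitI x -> unitI y -> unitI z ->
    T x (T y z) = T (T x y) z;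
  tnorm_ndl : forall x y z, unitI x -> unitI y -> unitI z ->
    x <= y -> T x z <= T y z;
  tnorm_ndr : forall x y z, unitI x -> unitI y -> unitI z ->
    y <= z -> T x y <= T x z;
  tnorm1x : forall x, unitI x -> T 1 x = x }.

Record strict_tnorm (R : realType) (T : R -> R -> R) : Prop := StrictTnorm {
  strict_tnormW : tnorm T;
  strict_tnorm_continuous :
    {within unitI `*` unitI, continuous (fun z : R * R => T z.1 z.2)};
  strict_tnorm_lt : forall x y z, unitI x -> unitI y -> unitI z ->
    0 < x -> y < z -> T x y < T x z }.

(* tau^-1 : [0,+oo] -> [0,1]; also used for zeta below. *)
Definition gen_inv (R : realType) (tau : R -> \bar R) : \bar R -> R :=
  pinv unitI tau.

Record additive_generator (R : realType) (T : R -> R -> R) (tau : R -> \bar R)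
    : Prop := AdditiveGenerator {
  generator_continuous : {within unitI, continuous tau};
  generator_decr : forall x y, unitI x -> unitI y ->
    x < y -> (tau y < tau x)%E;
  generator_bij : set_bij unitI [set a | (0 <= a)%E] tau;
  generator1 : tau 1 = 0%E;
  generator0 : tau 0 = +oo%E;
  generatorE : forall x y, unitI x -> unitI y ->
    T x y = gen_inv tau (tau x + tau y)%E }.

Definition dual_conorm (R : realType) (T : R -> R -> R) : R -> R -> R :=
  fun x y => 1 - T (1 - x) (1 - y).

Definition dual_generator (R : realType) (tau : R -> \bar R) : R -> \bar R :=
  fun x => tau (1 - x).

Record triple (R : realType) :=
  Triple { pf_mu : R; pf_eta : R; pf_nu : R }.

Definition is_pfn (R : realType) (a : triple R) : Prop :=
  [/\ unitI (pf_mu a), unitI (pf_eta a), unitI (pf_nu a)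
    & pf_mu a + pf_eta a + pf_nu a <= 1].

Definition pf_add (R : realType) (T : R -> R -> R) (a b : triple R) :
    triple R :=
  Triple (dual_conorm T (pf_mu a) (pf_mu b))
    (T (pf_eta a + pf_nu a) (pf_eta b + pf_nu b) - T (pf_nu a) (pf_nu b))
    (T (pf_nu a) (pf_nu b)).

Definition pf_mul (R : realType) (T : R -> R -> R) (a b : triple R) :
    triple R :=
  Triple (T (pf_mu a) (pf_mu b))
    (T (pf_eta a + pf_mu a) (pf_eta b + pf_mu b) - T (pf_mu a) (pf_mu b))
    (dual_conorm T (pf_nu a) (pf_nu b)).

Definition pf_scale (R : realType) (tau : R -> \bar R) (l : R) (a : triple R) :
    triple R :=
  let zeta := dual_generator tau in
  Triple (gen_inv zeta (l%:E * zeta (pf_mu a))%E)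
    (gen_inv tau (l%:E * tau (pf_eta a + pf_nu a)%R)%E
       - gen_inv tau (l%:E * tau (pf_nu a))%E)
    (gen_inv tau (l%:E * tau (pf_nu a))%E).

Definition pf_pow (R : realType) (tau : R -> \bar R) (a : triple R) (l : R) :
    triple R :=
  let zeta := dual_generator tau in
  Triple (gen_inv tau (l%:E * tau (pf_mu a))%E)
    (gen_inv tau (l%:E * tau (pf_eta a + pf_mu a)%R)%E
       - gen_inv tau (l%:E * tau (pf_mu a))%E)
    (gen_inv zeta (l%:E * zeta (pf_nu a))%E).

Definition pf_zero (R : realType) : triple R := Triple 0 0 1.
Arguments pf_zero {R}.

(* pf_zero is neutral for pf_add on PFNs, hence can be used as the value of the
   empty sum: it does not change the value of a nonempty one. *)
Lemma pf_addx0 (R : realType) (T : R -> R -> R) (a : triple R) :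
  tnorm T -> is_pfn a -> pf_add T a pf_zero = a.
Proof.
move=> tT; case: a => m e v [] /=; rewrite /unitI /= !in_itv /=.
move=> /andP[m0 m1] /andP[e0 e1] /andP[v0 v1] mev.
have T1 x : 0 <= x -> x <= 1 -> T x 1 = x.
  move=> x0 x1; rewrite (tnormC tT) ?(tnorm1x tT) //;
  by rewrite /unitI /= in_itv /= ?x0 ?x1 ?ler01 ?lexx.
have ev1 : e + v <= 1 by apply: le_trans mev; rewrite -addrA lerDr.
rewrite /pf_add /dual_conorm /= add0r subr0.
by rewrite !T1 ?subr_ge0 ?addr_ge0 ?gerBl // subKr addrK.
Qed.

Definition PFIBM (R : realType) (T : R -> R -> R) (tau : R -> \bar R)
    (p q : R) (n : nat) (alpha : 'I_n -> triple R) : triple R :=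
  pf_pow tau
    (pf_scale tau (n%:R * (n%:R - 1))^-1
      (\big[pf_add T/pf_zero]_(ij : 'I_n * 'I_n | ij.1 != ij.2)
         pf_mul T (pf_pow tau (alpha ij.1) p) (pf_pow tau (alpha ij.2) q)))
    (p + q)^-1.

(* Main.v *)
Require Import Defs.
From mathcomp Require Import all_boot all_order all_algebra all_fingroup.
From mathcomp Require Import all_classical all_reals all_analysis.
Import Order.TTheory GRing.Theory Num.Theory.
Local Open Scope ring_scope.

Set Implicit Arguments.
Unset Strict Implicit.
Unset Printing Implicit Defensive.

(** The terms of the sum are picture fuzzy numbers, on which [pf_add] is
    commutative and associative, so the sum may be reindexed along
    [(i, j) |-> (s i, s j)]. In the coordinates [(mu, eta + nu, nu)], [pf_add]
    acts componentwise by the dual conorm, [T] and [T]; that PFNs are preserved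
    amounts to the chain [0 <= nu <= eta + nu <= 1 - mu] and the monotonicity
    of the functions applied. *)

(* [pf_add] is a commutative monoid law only on PFNs, so [perm_big] does not
   apply. *)
Lemma big_perm_in (A : Type) (I : eqType) (P : A -> Prop) (op : A -> A -> A)
    (idx : A) (Pidx : P idx) (Pop : forall a b, P a -> P b -> P (op a b))
    (opC : forall a b, P a -> P b -> op a b = op b a)
    (opA : forall a b c, P a -> P b -> P c -> op a (op b c) = op (op a b) c)
    (Q : pred I) (F : I -> A) (PF : forall i, P (F i)) (r1 r2 : seq I) :
  perm_eq r1 r2 ->
  \big[op/idx]_(i <- r1 | Q i) F i = \big[op/idx]_(i <- r2 | Q i) F i.
Proof.
have Pbig r : P (\big[op/idx]_(i <- r | Q i) F i) by apply: big_ind.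
have opCA a b c : P a -> P b -> P c -> op a (op b c) = op b (op a c).
  by move=> Pa Pb Pc; rewrite !opA// (opC a b).
(* The term of [x] moves past those of [s] one at a time by [opCA], which applies because the
   remaining sum satisfies [P] by [Pbig]. *)
have front x s t : \big[op/idx]_(i <- s ++ x :: t | Q i) F i =
    \big[op/idx]_(i <- x :: s ++ t | Q i) F i.
  elim: s => [//|y s IH]; rewrite cat_cons big_cons IH cat_cons !big_cons.
  by case: (Q x); case: (Q y) => //; rewrite opCA.
elim: r1 r2 => [|x r1 IH] r2 r12.
  by move: r12; rewrite perm_sym => /perm_nilP ->.
have x_r2 : x \in r2 by rewrite -(perm_mem r12) mem_head.
case/splitPr: x_r2 r12 => s t; rewrite perm_sym perm_catC cat_cons perm_cons.
rewrite perm_catC perm_sym => /IH r1st.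
by rewrite front !big_cons r1st.
Qed.

Lemma unitIP (R : realType) (x : R) : unitI x <-> 0 <= x <= 1.
Proof. by rewrite /unitI /= in_itv. Qed.

Lemma unitI_onem (R : realType) (x : R) : unitI x -> unitI (1 - x).
Proof. by rewrite !unitIP subr_ge0 gerBl => /andP[-> ->]. Qed.

(** The middle entry is a difference because the operations produce triples of this shape, with [y]
    in the role of [eta + nu]. *)
Lemma is_pfn_chain (R : realType) (m x y : R) :
  0 <= m -> 0 <= x -> x <= y -> y <= 1 - m -> is_pfn (Triple m (y - x) x).
Proof.
move=> m0 x0 xy ym.
have ym1 : m + y <= 1 by rewrite addrC -lerBrDr.
have y0 : 0 <= y := le_trans x0 xy.
have m1 : m <= 1 by apply: le_trans ym1; rewrite lerDl.
have y1 : y <= 1 by apply: le_trans ym1; rewrite lerDr.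
split; rewrite /= ?unitIP ?m0 ?x0 ?subr_ge0 ?xy//=.
- by apply: le_trans y1; rewrite gerBl.
- exact: le_trans y1.
- by rewrite -addrA subrK.
Qed.

Lemma is_pfnP (R : realType) (a : triple R) : is_pfn a ->
  [/\ unitI (pf_mu a), unitI (pf_nu a), unitI (pf_eta a + pf_nu a),
    pf_nu a <= pf_eta a + pf_nu a & pf_eta a + pf_nu a <= 1 - pf_mu a].
Proof.
case=> mI; rewrite [unitI (pf_eta a)]unitIP => /andP[e0 e1] vI mev.
have ev : pf_eta a + pf_nu a <= 1 - pf_mu a by rewrite lerBrDr addrC addrA.
have [/unitIP/andP[m0 _] /unitIP/andP[v0 _]] := (mI, vI).
split=> //; last by rewrite lerDr.
by apply/unitIP; rewrite addr_ge0//= (le_trans ev)// gerBl.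
Qed.

Lemma tnorm_le2 (R : realType) (T : R -> R -> R) (x y z t : R) : tnorm T ->
  unitI x -> unitI y -> unitI z -> unitI t -> x <= z -> y <= t ->
  T x y <= T z t.
Proof.
move=> hT Ix Iy Iz It xz yt.
exact: le_trans (tnorm_ndl hT Ix Iz Iy xz) (tnorm_ndr hT Iz Iy It yt).
Qed.

Lemma dual_conorm_unitI (R : realType) (T : R -> R -> R) (x y : R) : tnorm T ->
  unitI x -> unitI y -> unitI (dual_conorm T x y).
Proof.
by move=> hT Ix Iy; apply/unitI_onem/(tnorm_unitI hT); apply: unitI_onem.
Qed.

Lemma dual_conormC (R : realType) (T : R -> R -> R) (x y : R) : tnorm T ->
  unitI x -> unitI y -> dual_conorm T x y = dual_conorm T y x.
Proof.
by move=> hT Ix Iy; rewrite /dual_conorm (tnormC hT)//; apply: unitI_onem.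
Qed.

Lemma dual_conormA (R : realType) (T : R -> R -> R) (x y z : R) : tnorm T ->
  unitI x -> unitI y -> unitI z ->
  dual_conorm T x (dual_conorm T y z) = dual_conorm T (dual_conorm T x y) z.
Proof.
move=> hT Ix Iy Iz.
by rewrite /dual_conorm !subKr (tnormA hT)//; apply: unitI_onem.
Qed.

(** Conjugation by this involution turns [pf_add] into [pf_mul], so closure is proved for one and
    transferred to the other. *)
Definition pf_swap (R : realType) (a : triple R) : triple R :=
  Triple (pf_nu a) (pf_eta a) (pf_mu a).

Lemma is_pfn_swap (R : realType) (a : triple R) : is_pfn a -> is_pfn (pf_swap a).
Proof. by case=> mI eI vI mev; split=> //=; rewrite addrC (addrC (pf_nu a)) addrA. Qed.

Lemma is_pfn_zero (R : realType) : is_pfn (@pf_zero R).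
Proof. by split; rewrite /= ?unitIP ?lexx ?ler01 ?addr0 ?add0r. Qed.

Lemma is_pfn_add (R : realType) (T : R -> R -> R) (a b : triple R) : tnorm T ->
  is_pfn a -> is_pfn b -> is_pfn (pf_add T a b).
Proof.
move=> hT /is_pfnP[am av aev ale ale'] /is_pfnP[bm bv bev ble ble'].
apply: is_pfn_chain.
- by have /unitIP/andP[] := dual_conorm_unitI hT am bm.
- by have /unitIP/andP[] := tnorm_unitI hT av bv.
- exact: tnorm_le2.
(* One minus the dual conorm is [T] at the complements, so this bound is again monotonicity of
   [T]. *)
- by rewrite /dual_conorm subKr; apply: tnorm_le2 => //; apply: unitI_onem.
Qed.

Lemma is_pfn_mul (R : realType) (T : R -> R -> R) (a b : triple R) : tnorm T ->
  is_pfn a -> is_pfn b -> is_pfn (pf_mul T a b).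
Proof.
move=> hT /is_pfn_swap ha /is_pfn_swap hb.
exact: is_pfn_swap (is_pfn_add hT ha hb).
Qed.

Lemma pf_addC (R : realType) (T : R -> R -> R) (a b : triple R) : tnorm T ->
  is_pfn a -> is_pfn b -> pf_add T a b = pf_add T b a.
Proof.
move=> hT /is_pfnP[am av aev _ _] /is_pfnP[bm bv bev _ _].
by congr Triple; [exact: dual_conormC | congr (_ - _) |]; apply: (tnormC hT).
Qed.

Lemma pf_addA (R : realType) (T : R -> R -> R) (a b c : triple R) : tnorm T ->
  is_pfn a -> is_pfn b -> is_pfn c ->
  pf_add T a (pf_add T b c) = pf_add T (pf_add T a b) c.
Proof.
move=> hT /is_pfnP[am av aev _ _] /is_pfnP[bm bv bev _ _].
(* The subtracted [nu] part cancels in [eta + nu] of each inner sum, leaving a plain value of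
   [T]. *)
move=> /is_pfnP[cm cv cev _ _]; rewrite /pf_add /= !subrK.
by congr Triple; [exact: dual_conormA | congr (_ - _) |]; apply: (tnormA hT).
Qed.

Lemma generator_ge0 (R : realType) (T : R -> R -> R) (tau : R -> \bar R)
    (x : R) :
  additive_generator T tau -> unitI x -> (0 <= tau x)%E.
Proof. by move=> tauP; have [tauI _ _] := generator_bij tauP; apply: tauI. Qed.

Lemma gen_inv_unitI (R : realType) (T : R -> R -> R) (tau : R -> \bar R)
    (a : \bar R) :
  additive_generator T tau -> (0 <= a)%E -> unitI (gen_inv tau a).
Proof.
move=> tauP a0; have [_ _ tau_surj] := generator_bij tauP.
exact: (@surjpinv_image_sub _ _ _ _ _ _ tau_surj _ (ex_intro2 _ _ a a0 erefl)).
Qed.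

Lemma gen_invK (R : realType) (T : R -> R -> R) (tau : R -> \bar R)
    (a : \bar R) :
  additive_generator T tau -> (0 <= a)%E -> tau (gen_inv tau a) = a.
Proof.
move=> tauP a0; have [_ _ tau_surj] := generator_bij tauP.
by apply: (surjpK _ tau_surj); rewrite inE.
Qed.

(** Were the order of the two inverses reversed strictly, the strictly decreasing [tau] would give
    [b < a]. *)
Lemma gen_inv_noninc (R : realType) (T : R -> R -> R) (tau : R -> \bar R)
    (a b : \bar R) :
  additive_generator T tau -> (0 <= a)%E -> (a <= b)%E ->
  gen_inv tau b <= gen_inv tau a.
Proof.
move=> tauP a0 ab; have b0 := le_trans a0 ab.
rewrite leNgt; apply/negP => /(generator_decr tauP).
move=> /(_ (gen_inv_unitI tauP a0) (gen_inv_unitI tauP b0)).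
by rewrite !(gen_invK tauP)// ltNge ab.
Qed.

(** The right-hand side is a preimage of [a] in [unitI] under the dual generator, and injectivity
    there makes it the one that [pinv] selects. *)
Lemma dual_gen_inv (R : realType) (T : R -> R -> R) (tau : R -> \bar R)
    (a : \bar R) :
  additive_generator T tau -> (0 <= a)%E ->
  gen_inv (dual_generator tau) a = 1 - gen_inv tau a.
Proof.
move=> tauP a0; have Ia := gen_inv_unitI tauP a0.
have [_ tau_inj _] := generator_bij tauP.
have zeta_inj : {in unitI &, injective (dual_generator tau)}.
  move=> x y /set_mem Ix /set_mem Iy /tau_inj.
  rewrite !inE => /(_ (unitI_onem Ix) (unitI_onem Iy)).
  by move/(congr1 (fun z => 1 - z)); rewrite !subKr.
have {1}-> : a = dual_generator tau (1 - gen_inv tau a).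
  by rewrite /dual_generator subKr (gen_invK tauP).
by rewrite /gen_inv (pinvKV _ zeta_inj)// inE; apply: unitI_onem.
Qed.

(** Both [tau] and its inverse reverse the order, and the two reversals cancel. *)
Lemma gen_pow_le (R : realType) (T : R -> R -> R) (tau : R -> \bar R)
    (l x y : R) :
  additive_generator T tau -> 0 <= l -> unitI x -> unitI y -> x <= y ->
  gen_inv tau (l%:E * tau x)%E <= gen_inv tau (l%:E * tau y)%E.
Proof.
move=> tauP l0 Ix Iy; rewrite le_eqVlt => /predU1P[->//|xy].
apply: (gen_inv_noninc tauP).
  by rewrite mule_ge0 ?lee_fin ?(generator_ge0 tauP).
by rewrite lee_wpmul2l ?lee_fin// ltW// (generator_decr tauP).
Qed.

Lemma is_pfn_pow (R : realType) (T : R -> R -> R) (tau : R -> \bar R)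
    (l : R) (a : triple R) :
  additive_generator T tau -> 0 <= l ->
  is_pfn a -> is_pfn (pf_pow tau a l).
Proof.
move=> tauP l0 /is_pfn_swap/is_pfnP[/= Iv Im Iem ale ale'].
have tau_ge0 x : unitI x -> (0 <= l%:E * tau x)%E.
  by move=> Ix; rewrite mule_ge0 ?lee_fin ?(generator_ge0 tauP).
have Iv' := unitI_onem Iv.
(* With [g x] standing for [gen_inv tau (l%:E * tau x)], the last entry is [1 - g (1 - nu)]. After
   the swap, the chain to prove is [0 <= g mu <= g (eta + mu) <= g (1 - nu)]. *)
have zetaE : gen_inv (dual_generator tau) (l%:E * dual_generator tau (pf_nu a))
    = 1 - gen_inv tau (l%:E * tau (1 - pf_nu a)%R)%E.
  by rewrite (dual_gen_inv tauP) ?tau_ge0.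
rewrite /pf_pow zetaE; apply: (@is_pfn_swap _ (Triple _ _ _)).
apply: is_pfn_chain; rewrite ?subKr; try exact: (gen_pow_le tauP).
- by have /unitI_onem/unitIP/andP[] := gen_inv_unitI tauP (tau_ge0 _ Iv').
- by have /unitIP/andP[] := gen_inv_unitI tauP (tau_ge0 _ Im).
Qed.

Theorem mainTheorem5 (R : realType) (n : nat) (T : R -> R -> R)
    (tau : R -> \bar R) (p q : R) (alpha : 'I_n -> triple R)
    (hn : (2 <= n)%N) (hT : strict_tnorm T) (htau : additive_generator T tau)
    (hp : 0 < p) (hq : 0 < q) (halpha : forall i, is_pfn (alpha i))
    (s : {perm 'I_n}) :
  PFIBM T tau p q alpha = PFIBM T tau p q (fun i => alpha (s i)).
Proof.
have tT := strict_tnormW hT.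
(* Both sides apply the same scaling and power, so it is enough to compare the two sums. *)
rewrite /PFIBM; congr (pf_pow _ (pf_scale _ _ _) _).
pose h (ij : 'I_n * 'I_n) := (s ij.1, s ij.2).
have h_inj : injective h by move=> [i j] [k l] [/perm_inj -> /perm_inj ->].
have h_perm : perm_eq (index_enum ('I_n * 'I_n)%type)
    [seq h ij | ij <- index_enum ('I_n * 'I_n)%type].
  apply: uniq_perm; rewrite ?map_inj_uniq ?index_enum_uniq// => ij.
  rewrite mem_index_enum; apply/esym/mapP.
  exists ((s^-1)%g ij.1, (s^-1)%g ij.2); first exact: mem_index_enum.
  by rewrite /h /= !permKV; case: ij.
rewrite (@big_perm_in _ _ (@is_pfn R) _ _ _ _ _ _ _ _ _ _ _ h_perm).
- rewrite big_map; apply: eq_bigl => ij /=.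
  (* Injectivity of [s] keeps the off-diagonal condition invariant under [h]. *)
  by rewrite (inj_eq perm_inj).
- exact: is_pfn_zero.
- by move=> a b; apply: is_pfn_add.
- by move=> a b; apply: pf_addC.
- by move=> a b c; apply: pf_addA.
- by move=> ij; apply: is_pfn_mul => //; apply: (is_pfn_pow htau) => //; apply: ltW.
Qed.
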